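(* Let $\mathbb{F}$ be a finite field, let $\mathcal{C}\subseteq\mathbb{F}^n$ be a $k$-dimensional linear code with support $\mathcal{I}=\{0,\ldots,n-1\}$, generator matrix $G\in\mathbb{F}^{k\times n}$ and parity check matrix $H\in\mathbb{F}^{(n-k)\times n}$, and let $\mathcal{S}=[(a_l,b_l],\,l=1,\ldots,k]$ be a span list for $G$. Consider the BCJR-trellis $T_{(G,H,\mathcal{S})}$ and the product trellis $T_{G,\mathcal{S}}$ along with their defining matrices $N_i\in\mathbb{F}^{k\times(n-k)}$ and $M_i\in\mathbb{F}^{k\times k}$, $i\in\mathcal{I}$, respectively. Then (a) for each $i\in\mathcal{I}$ there exists a subspace $W_i\subseteq\operatorname{im}M_i$ such that $\ker M_i\oplus W_i=\ker N_i$; (b) for such subspaces $W_i$, the quotient trellis $T'=(V',E')$ of $T_{G,\mathcal{S}}$ defined by $$V_i'=\operatorname{im}M_i/W_i,\qquad E_i'=\{(\alpha M_i+W_i,\ \alpha G_i,\ \alpha M_{i+1}+W_{i+1})\mid\alpha\in\mathbb{F}^k\},\quad i\in\mathcal{I},$$ is isomorphic to the BCJR-trellis $T_{(G,H,\mathcal{S})}$. In particular, $\mathcal{C}(T')=\mathcal{C}$.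
   Context: Conventions. For a matrix $M\in\mathbb{F}^{k\times r}$, $\operatorname{im}M=\{\alpha M\mid\alpha\in\mathbb{F}^k\}$ is the row space and $\ker M=\{\alpha\in\mathbb{F}^k\mid\alpha M=0\}$ is the left kernel. Trellises. A (tail-biting) trellis $T=(V,E)$ of depth $n$ over $\mathbb{F}$ has a vertex set that is the disjoint union $V=V_0\cup\ldots\cup V_{n-1}$ and edge sets $E_i\subseteq V_i\times\mathbb{F}\times V_{i+1}$ for $i\in\mathcal{I}=\{0,\ldots,n-1\}$ (time indices are always taken modulo $n$); $(v,a,w)\in E_i$ is an edge from $v$ to $w$ with label $a$. A cycle is a closed path of length $n$ starting and ending at the same vertex of $V_0$. The edge-label code $\mathcal{C}(T)\subseteq\mathbb{F}^n$ is the set of label sequences of all cycles of $T$. Trellises $T,T'$ whose vertex sets $V_i,V_i'$ are $\mathbb{F}$-vector spaces are isomorphic if there are vector space isomorphisms $\phi_i:V_i\to V_i'$, $i\in\mathcal{I}$, such that $(v,a,w)\in E_i\Leftrightarrow(\phi_i(v),a,\phi_{i+1}(w))\in E_i'$. Spans. For $a,b\in\mathcal{I}$ put $[a,b]=\{a,\ldots,b\}$ if $a\le b$ and $[a,b]=\{a,\ldots,n-1,0,\ldots,b\}$ if $a>b$, and $(a,b]=[a,b]\setminus\{a\}$. The interval $(a,b]$ is a span of a nonzero vector $c\in\mathbb{F}^n$ (coordinates indexed by $\mathcal{I}$) if $c_a\ne0\ne c_b$ and $c_j=0$ for $j\notin[a,b]$. A span list for $G$ is a list $\mathcal{S}=[(a_l,b_l],\,l=1,\ldots,k]$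 where $(a_l,b_l]$ is a span of the $l$-th row of $G$. Product trellis. Let $G_0,\ldots,G_{n-1}$ be the columns of $G=(g_{lj})$. Let $M_i\in\mathbb{F}^{k\times k}$ be the diagonal matrix whose $l$-th diagonal entry is $1$ if $i\in(a_l,b_l]$ and $0$ otherwise. The product trellis $T_{G,\mathcal{S}}$ has vertex spaces $\operatorname{im}M_i$ and edge spaces $\operatorname{im}(M_i,G_i,M_{i+1})=\{(\alpha M_i,\alpha G_i,\alpha M_{i+1})\mid\alpha\in\mathbb{F}^k\}$, $i\in\mathcal{I}$. BCJR-trellis. Let $H_0,\ldots,H_{n-1}\in\mathbb{F}^{n-k}$ be the rows of $H^{\sf T}$, where $\mathcal{C}=\{\alpha G\mid\alpha\in\mathbb{F}^k\}=\{c\in\mathbb{F}^n\mid cH^{\sf T}=0\}$. Let $N_0\in\mathbb{F}^{k\times(n-k)}$ be the matrix with rows $\sum_{j=a_l}^{n-1}g_{lj}H_j$, $l=1,\ldots,k$, and $N_i=N_{i-1}+G_{i-1}H_{i-1}$ (column times row) for $i=1,\ldots,n$; then $N_n=N_0$. The BCJR-trellis $T_{(G,H,\mathcal{S})}$ has vertex spaces $\operatorname{im}N_i$ and edge spaces $\operatorname{im}(N_i,G_i,N_{i+1})$, $i\in\mathcal{I}$. It is known that $T_{G,\mathcal{S}}$ and $T_{(G,H,\mathcal{S})}$ both represent $\mathcal{C}$, i.e. have edge-label code $\mathcal{C}$. *)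

(* Defs.v *)
From HB Require Import structures.
From mathcomp Require Import all_boot all_order all_algebra.

Set Implicit Arguments.
Unset Strict Implicit.
Unset Printing Implicit Defensive.

Import GRing.Theory.
Local Open Scope ring_scope.
Local Open Scope quotient_scope.

(* Matrices act on row vectors from the right, so mxim is the row space and   *)
(* mxker the left kernel.                                                     *)
Definition mxim (F : fieldType) (k r : nat) (M : 'M[F]_(k, r)) :
    {vspace 'rV[F]_r} := limg (linfun (mulmxr M : 'rV[F]_k -> 'rV[F]_r)).

Definition mxker (F : fieldType) (k r : nat) (M : 'M[F]_(k, r)) :
    {vspace 'rV[F]_k} := lker (linfun (mulmxr M : 'rV[F]_k -> 'rV[F]_r)).

Lemma mem_mxim (F : fieldType) (k r : nat) (M : 'M[F]_(k, r)) (u : 'rV[F]_k) :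
  u *m M \in mxim M.
Proof.
have -> : u *m M = linfun (mulmxr M : 'rV[F]_k -> 'rV[F]_r) u by rewrite lfunE.
by apply: memv_img; apply: memvf.
Qed.

Lemma mximP (F : fieldType) (k r : nat) (M : 'M[F]_(k, r)) (v : 'rV[F]_r) :
  reflect (exists u : 'rV[F]_k, v = u *m M) (v \in mxim M).
Proof.
apply: (iffP idP) => [/memv_imgP[u _ ->]|[u ->]]; last exact: mem_mxim.
by exists u; rewrite lfunE.
Qed.

Lemma mem_mxker (F : fieldType) (k r : nat) (M : 'M[F]_(k, r)) (u : 'rV[F]_k) :
  (u \in mxker M) = (u *m M == 0).
Proof. by rewrite memv_ker lfunE. Qed.

Definition mximv (F : fieldType) (k r : nat) (M : 'M[F]_(k, r))
  (u : 'rV[F]_k) : subvs_of (mxim M) := Subvs (mem_mxim M u).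

(* The library equips the quotient by an additive subgroup with a zmodType    *)
(* structure only; vquot adds the scalar multiplication.                      *)
Definition vquot (F : fieldType) (vT : vectType F) (W : {vspace vT}) : Type :=
  Quotient.quot W.

HB.instance Definition _ (F : fieldType) (vT : vectType F) (W : {vspace vT}) :=
  GRing.Zmodule.on (vquot W).

Section VQuot.

Variables (F : fieldType) (vT : vectType F) (W : {vspace vT}).

Definition vpi (x : vT) : vquot W := \pi_(Quotient.quot W) x.

Lemma vpi_eq (x y : vT) : (vpi x = vpi y) <-> (x - y \in W).
Proof.
by rewrite /vpi Quotient.idealrBE; split=> [-> //|/eqP].
Qed.

Lemma vpi_surj (q : vquot W) : exists x, q = vpi x.
Proof. by exists (repr (q : Quotient.quot W)); rewrite /vpi reprK. Qed.

Lemma vpiD (x y : vT) : vpi (x + y) = vpi x + vpi y.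
Proof. exact: (Quotient.pi_add W x y). Qed.

Definition vquot_scale (a : F) (q : vquot W) : vquot W :=
  vpi (a *: repr (q : Quotient.quot W)).

Lemma vquot_scaleE (a : F) (x : vT) : vquot_scale a (vpi x) = vpi (a *: x).
Proof.
apply/vpi_eq; rewrite -scalerBr; apply: memvZ.
by apply/vpi_eq; rewrite /vpi reprK.
Qed.

Fact vquot_scaleA (a b : F) (q : vquot W) :
  vquot_scale a (vquot_scale b q) = vquot_scale (a * b) q.
Proof. by have [x ->] := vpi_surj q; rewrite !vquot_scaleE scalerA. Qed.

Fact vquot_scale1 : left_id 1 vquot_scale.
Proof. by move=> q; have [x ->] := vpi_surj q; rewrite vquot_scaleE scale1r. Qed.

Fact vquot_scaleDr : right_distributive vquot_scale +%R.
Proof.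
move=> a p q; have [x ->] := vpi_surj p; have [y ->] := vpi_surj q.
by rewrite -vpiD !vquot_scaleE scalerDr vpiD.
Qed.

Fact vquot_scaleDl (q : vquot W) : {morph vquot_scale^~ q : a b / a + b}.
Proof.
move=> a b; have [x ->] := vpi_surj q.
by rewrite !vquot_scaleE scalerDl vpiD.
Qed.

HB.instance Definition _ := GRing.Zmodule_isLmodule.Build F (vquot W)
  vquot_scaleA vquot_scale1 vquot_scaleDr vquot_scaleDl.

Lemma vpiZ (a : F) (x : vT) : vpi (a *: x) = a *: vpi x.
Proof. by rewrite -vquot_scaleE. Qed.

End VQuot.

(* U / W for subspaces U, W of vT, where W is meant to be included in U.      *)
Definition subquot (F : fieldType) (vT : vectType F) (U W : {vspace vT}) :
    lmodType F :=
  vquot (linfun (vsval : subvs_of U -> vT) @^-1: W)%VS.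

Definition subpi (F : fieldType) (vT : vectType F) (U W : {vspace vT})
  (u : subvs_of U) : subquot U W := vpi _ u.

Lemma subpi_eq (F : fieldType) (vT : vectType F) (U W : {vspace vT})
    (u v : subvs_of U) :
  subpi W u = subpi W v <-> vsval u - vsval v \in W.
Proof.
have -> : vsval u - vsval v = linfun (vsval : subvs_of U -> vT) (u - v).
  by rewrite -[vsval u - vsval v]/(vsval (u - v)) lfunE.
by rewrite memv_preim; exact: vpi_eq.
Qed.

(* Tail-biting trellises of depth n whose vertex sets are vector spaces. The  *)
(* vertex sets are disjoint because they are indexed; ordS i is i + 1 mod n.  *)
Record trellis (F : fieldType) (n : nat) : Type := Trellis {
  vertex : 'I_n -> lmodType F;
  edge : forall i : 'I_n, vertex i -> F -> vertex (ordS i) -> Prop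
}.

Definition edge_label_code (F : fieldType) (n : nat) (T : trellis F n)
    (c : 'rV[F]_n) : Prop :=
  exists v : forall i : 'I_n, vertex T i,
    forall i : 'I_n, edge (v i) (c 0 i) (v (ordS i)).

Definition trellis_iso (F : fieldType) (n : nat) (T T' : trellis F n) : Prop :=
  exists phi : forall i : 'I_n, {linear vertex T i -> vertex T' i},
    (forall i : 'I_n, bijective (phi i)) /\
    (forall (i : 'I_n) (v : vertex T i) (a : F) (w : vertex T (ordS i)),
       edge v a w <-> edge (phi i v) a (phi (ordS i) w)).

Definition cinterval (n : nat) (a b : 'I_n) : {set 'I_n} :=
  if (a <= b)%N then [set j : 'I_n | (a <= j <= b)%N]
  else [set j : 'I_n | (a <= j)%N || (j <= b)%N].

Definition cspan (n : nat) (s : 'I_n * 'I_n) : {set 'I_n} :=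
  cinterval s.1 s.2 :\ s.1.

(* A span is kept as the pair (a, b): the set (a, b] does not determine a     *)
(* when a = b.                                                                *)
Definition is_span (F : fieldType) (n : nat) (c : 'rV[F]_n)
    (s : 'I_n * 'I_n) : Prop :=
  [/\ c 0 s.1 != 0, c 0 s.2 != 0 &
      forall j : 'I_n, j \notin cinterval s.1 s.2 -> c 0 j = 0].

Definition is_span_list (F : fieldType) (k n : nat) (G : 'M[F]_(k, n))
    (S : k.-tuple ('I_n * 'I_n)) : Prop :=
  forall l : 'I_k, is_span (row l G) (tnth S l).

Definition full_support (F : fieldType) (n : nat) (C : {vspace 'rV[F]_n}) :
    Prop :=
  forall i : 'I_n, exists2 c : 'rV[F]_n, c \in C & c 0 i != 0.

Definition matrix_trellis (F : fieldType) (k r n : nat) (G : 'M[F]_(k, n))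
    (X : 'I_n -> 'M[F]_(k, r)) : trellis F n :=
  @Trellis F n (fun i => subvs_of (mxim (X i)))
    (fun i v a w => exists u : 'rV[F]_k,
       [/\ v = mximv (X i) u, a = (u *m col i G) 0 0 &
           w = mximv (X (ordS i)) u]).

Definition product_mx (F : fieldType) (k n : nat)
    (S : k.-tuple ('I_n * 'I_n)) (i : 'I_n) : 'M[F]_k :=
  diag_mx (\row_(l < k) (i \in cspan (tnth S l))%:R).

Definition product_trellis (F : fieldType) (k n : nat) (G : 'M[F]_(k, n))
    (S : k.-tuple ('I_n * 'I_n)) : trellis F n :=
  matrix_trellis G (product_mx F S).

Definition bcjr_mx0 (F : fieldType) (k m n : nat) (G : 'M[F]_(k, n))
    (H : 'M[F]_(m, n)) (S : k.-tuple ('I_n * 'I_n)) : 'M[F]_(k, m) :=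
  \matrix_(l < k)
    \sum_(j < n | ((tnth S l).1 <= j)%N) G l j *: row j H^T.

(* For every natural number i, so that the recursion also yields N_n; the     *)
(* value 0 is taken only in the irrelevant case j >= n.                       *)
Fixpoint bcjr_mx (F : fieldType) (k m n : nat) (G : 'M[F]_(k, n))
    (H : 'M[F]_(m, n)) (S : k.-tuple ('I_n * 'I_n)) (i : nat) : 'M[F]_(k, m) :=
  if i is j.+1 then
    bcjr_mx G H S j +
      (if insub j is Some j' then col j' G *m row j' H^T else 0)
  else bcjr_mx0 G H S.

Lemma bcjr_mxS (F : fieldType) (k m n : nat) (G : 'M[F]_(k, n))
    (H : 'M[F]_(m, n)) (S : k.-tuple ('I_n * 'I_n)) (i : 'I_n) :
  bcjr_mx G H S i.+1 = bcjr_mx G H S i + col i G *m row i H^T.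
Proof. by rewrite /= valK. Qed.

Lemma bcjr_mx_n (F : fieldType) (k m n : nat) (G : 'M[F]_(k, n))
    (H : 'M[F]_(m, n)) (S : k.-tuple ('I_n * 'I_n)) :
  G *m H^T = 0 -> bcjr_mx G H S n = bcjr_mx G H S 0.
Proof.
move=> GH0.
have step p : (p <= n)%N -> bcjr_mx G H S p =
    bcjr_mx0 G H S + \sum_(j < n | (j < p)%N) col j G *m row j H^T.
  elim: p => [_|p IHp ltpn]; first by rewrite big_pred0 ?addr0.
  rewrite (bcjr_mxS G H S (Ordinal ltpn)) /= IHp 1?ltnW // -addrA.
  congr (_ + _); rewrite [RHS](bigD1 (Ordinal ltpn)) //= addrC.
  congr (_ + _); apply: eq_bigl => j.
  by rewrite ltnS [RHS]andbC -val_eqE /= -ltn_neqAle.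
rewrite step //= (eq_bigl xpredT) => [|j]; last exact: ltn_ord.
rewrite -[RHS]addr0 -[X in _ = _ + X]GH0; congr (_ + _); apply/matrixP => l m'.
rewrite summxE mxE; apply: eq_bigr => j _.
by rewrite !mxE big_ord1 !mxE.
Qed.

Definition bcjr_trellis (F : fieldType) (k m n : nat) (G : 'M[F]_(k, n))
    (H : 'M[F]_(m, n)) (S : k.-tuple ('I_n * 'I_n)) : trellis F n :=
  matrix_trellis G (fun i : 'I_n => bcjr_mx G H S i).

Definition complement_at (F : fieldType) (k m n : nat) (G : 'M[F]_(k, n))
    (H : 'M[F]_(m, n)) (S : k.-tuple ('I_n * 'I_n)) (i : 'I_n)
    (W : {vspace 'rV[F]_k}) : Prop :=
  [/\ (W <= mxim (product_mx F S i))%VS,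
      directv (mxker (product_mx F S i) + W) &
      (mxker (product_mx F S i) + W)%VS = mxker (bcjr_mx G H S i)].

Definition quotient_trellis (F : fieldType) (k n : nat) (G : 'M[F]_(k, n))
    (S : k.-tuple ('I_n * 'I_n)) (W : 'I_n -> {vspace 'rV[F]_k}) :
    trellis F n :=
  @Trellis F n (fun i => subquot (mxim (product_mx F S i)) (W i))
    (fun i v a w => exists u : 'rV[F]_k,
       [/\ v = subpi (W i) (mximv (product_mx F S i) u),
           a = (u *m col i G) 0 0 &
           w = subpi (W (ordS i)) (mximv (product_mx F S (ordS i)) u)]).

(* Main.v *)
(** Since [ker M_i <= ker N_i] and [M_i] is idempotent, [M_i *m N_i = N_i], so
    the map [alpha M_i + W_i |-> alpha N_i] is right multiplication by [N_i];
    its kernel on [im M_i] is [ker N_i :&: im M_i], which is [W_i]. Both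
    trellises carry the label [alpha G_i] on the edge of [alpha], hence these
    maps form an isomorphism. Along a cycle of the BCJR trellis with edges
    given by [u_i] and labels [c_i] one has
    [c_i H_i = u_(i+1) N_(i+1) - u_i N_i], and the sum over the cycle
    telescopes to [c H^T = 0]. *)
From HB Require Import structures.
Require Import Defs.
From mathcomp Require Import all_boot all_order all_algebra.
From mathcomp Require Import zify.

Set Implicit Arguments.
Unset Strict Implicit.
Unset Printing Implicit Defensive.

Import GRing.Theory.
Local Open Scope ring_scope.

Section VQuotLift.

Variables (F : fieldType) (vT : vectType F) (rT : lmodType F).
Variables (W : {vspace vT}) (f : {linear vT -> rT}).

(** The proof that [f] vanishes on [W] is an argument of the map, so that the linear structure below
    can be attached to the term itself. *)
Definition vquot_lift of (forall x, x \in W -> f x = 0) :=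
  fun q : vquot W => f (repr (q : Quotient.quot W)).

Hypothesis fW0 : forall x, x \in W -> f x = 0.

Lemma vquot_liftE x : vquot_lift fW0 (vpi W x) = f x.
Proof.
apply/eqP; rewrite -subr_eq0 /vquot_lift -linearB; apply/eqP/fW0.
by apply/vpi_eq; rewrite /vpi reprK.
Qed.

Fact vquot_lift_is_linear : linear (vquot_lift fW0).
Proof.
move=> a p q; have [x ->] := vpi_surj p; have [y ->] := vpi_surj q.
by rewrite -vpiZ -vpiD !vquot_liftE linearP.
Qed.

HB.instance Definition _ := GRing.isLinear.Build F (vquot W) rT *:%R
  (vquot_lift fW0) vquot_lift_is_linear.

End VQuotLift.

Fact mximv_is_linear (F : fieldType) (k r : nat) (M : 'M[F]_(k, r)) :
  linear (mximv M).
Proof. by move=> a u v; apply: val_inj; rewrite /= mulmxDl scalemxAl. Qed.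

HB.instance Definition _ (F : fieldType) (k r : nat) (M : 'M[F]_(k, r)) :=
  GRing.isLinear.Build F 'rV[F]_k (subvs_of (mxim M)) *:%R (mximv M)
    (mximv_is_linear M).

Section Idempotent.

Variables (F : fieldType) (k r : nat) (M : 'M[F]_k) (N : 'M[F]_(k, r)).
Hypotheses (MM : M *m M = M) (MN : M *m N = N).

Lemma mxim_idem u : u \in mxim M -> u *m M = u.
Proof. by case/mximP => v ->; rewrite -mulmxA MM. Qed.

(** The idempotent splits [u] as [(u - u *m M) + u *m M], with summands in [ker M] and [im M]; if
    [u] lies in [ker N], so does [u *m M]. *)
Lemma mxker_idem_complement :
  let W := (mxim M :&: mxker N)%VS in
  directv (mxker M + W) /\ (mxker M + W)%VS = mxker N.
Proof.
split.
  apply/directv_addP/eqP; rewrite -subv0; apply/subvP => u.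
  rewrite !memv_cap mem_mxker memv0 => /andP[/eqP uM0 /andP[/mxim_idem uM _]].
  by rewrite -uM uM0.
apply/vspaceP => u; apply/idP/idP.
  case/memv_addP => v; rewrite mem_mxker => /eqP vM0 [w].
  rewrite memv_cap mem_mxker => /andP[_ /eqP wN0] ->.
  by rewrite mem_mxker mulmxDl wN0 addr0 -MN mulmxA vM0 mul0mx.
rewrite mem_mxker => /eqP uN0; apply/memv_addP.
exists (u - u *m M); first by rewrite mem_mxker mulmxBl -mulmxA MM subrr.
exists (u *m M); last by rewrite subrK.
by rewrite memv_cap mem_mxim mem_mxker -mulmxA MN uN0 /=.
Qed.

(** Modular law, as [ker M] meets [im M] trivially. Hence every [W] admissible in (b) is the one
    constructed for (a). *)
Lemma mxker_capv_im (W : {vspace 'rV[F]_k}) :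
    (W <= mxim M)%VS -> (mxker M + W)%VS = mxker N ->
  (mxim M :&: mxker N)%VS = W.
Proof.
move=> sWM defN; apply/vspaceP => u; rewrite memv_cap -defN.
apply/andP/idP => [[/mxim_idem uM] | uW]; last first.
  by rewrite (subvP sWM) // (subvP (addvSr _ _)).
case/memv_addP => v; rewrite mem_mxker => /eqP vM0 [w wW uE].
by rewrite -uM uE mulmxDl vM0 add0r mxim_idem // (subvP sWM).
Qed.

End Idempotent.

Section QuotientIso.

Variables (F : fieldType) (k r : nat) (M : 'M[F]_k) (N : 'M[F]_(k, r)).
Variable W : {vspace 'rV[F]_k}.
Hypothesis MN : M *m N = N.
Hypothesis capW : (mxim M :&: mxker N)%VS = W.

Fact quot_mulmx_ker (x : subvs_of (mxim M)) :
    x \in (linfun (vsval : subvs_of (mxim M) -> 'rV[F]_k) @^-1: W)%VS ->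
  (mximv N \o vsval) x = 0.
Proof.
rewrite -memv_preim lfunE -capW memv_cap mem_mxker => /andP[_ /eqP xN0].
exact: val_inj.
Qed.

Definition quot_mulmx : {linear subquot (mxim M) W -> subvs_of (mxim N)} :=
  vquot_lift quot_mulmx_ker.

Lemma quot_mulmxE u : quot_mulmx (subpi W (mximv M u)) = mximv N u.
Proof.
have -> : quot_mulmx (subpi W (mximv M u)) = mximv N (u *m M).
  exact: (vquot_liftE quot_mulmx_ker).
by apply: val_inj; rewrite /= -mulmxA MN.
Qed.

Lemma subquotP (q : subquot (mxim M) W) : exists u, q = subpi W (mximv M u).
Proof.
have [x ->] := vpi_surj q; have /mximP[u xE] := subvsP x.
by exists u; congr (vpi _ _); apply: val_inj.
Qed.

Lemma quot_mulmx_inj : injective quot_mulmx.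
Proof.
move=> p q; have [u ->] := subquotP p; have [v ->] := subquotP q.
rewrite !quot_mulmxE => /(congr1 val) /= uvN.
apply/subpi_eq; rewrite /= -mulmxBl -capW memv_cap mem_mxim mem_mxker.
by rewrite -mulmxA MN mulmxBl uvN subrr /=.
Qed.

Lemma quot_mulmx_bij : bijective quot_mulmx.
Proof.
(* Stated with the boolean [==], so that [xchoose] can pick the preimages that define the
   inverse. *)
have surj (y : subvs_of (mxim N)) : exists u, y == mximv N u.
  by have /mximP[u yE] := subvsP y; exists u; apply/eqP/val_inj.
exists (fun y => subpi W (mximv M (xchoose (surj y)))) => [q | y].
  by apply: quot_mulmx_inj; rewrite quot_mulmxE -(eqP (xchooseP (surj _))).
by rewrite quot_mulmxE -(eqP (xchooseP (surj _))).
Qed.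

End QuotientIso.

Lemma product_mx_idem (F : fieldType) (k n : nat)
    (S : k.-tuple ('I_n * 'I_n)) (i : 'I_n) :
  product_mx F S i *m product_mx F S i = product_mx F S i.
Proof.
rewrite /product_mx mulmx_diag; congr diag_mx.
by apply/rowP => l; rewrite !mxE -natrM mulnb andbb.
Qed.

Section BCJR.

Variables (F : fieldType) (k m n : nat) (G : 'M[F]_(k, n)) (H : 'M[F]_(m, n)).
Variable S : k.-tuple ('I_n * 'I_n).

Lemma row_bcjr_mx p l : (p <= n)%N ->
  row l (bcjr_mx G H S p) =
    \sum_(j < n | ((tnth S l).1 <= j)%N) G l j *: row j H^T
    + \sum_(j < n | (j < p)%N) G l j *: row j H^T.
Proof.
elim: p => [_ | p IHp ltpn]; first by rewrite [X in _ + X]big_pred0 // addr0; apply: rowK.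
rewrite (bcjr_mxS G H S (Ordinal ltpn)) raddfD /= IHp 1?ltnW // -addrA.
congr (_ + _); rewrite [RHS](bigD1 (Ordinal ltpn)) //= addrC; congr (_ + _).
  by rewrite row_mul; apply/rowP => j; rewrite !mxE big_ord1 !mxE.
by apply: eq_bigl => j; rewrite ltnS [RHS]andbC -val_eqE /= -ltn_neqAle.
Qed.

Hypotheses (GH : G *m H^T = 0) (spanS : is_span_list G S).

Lemma row_bcjr_mx_out l (i : 'I_n) :
  i \notin cspan (tnth S l) -> row l (bcjr_mx G H S i) = 0.
Proof.
move=> iout.
(* Outside the span at time i, every coordinate of the l-th row in its interval
   is counted the same number c of times by the two sums of row_bcjr_mx, so
   the row of N_i is c times the row of G *m H^T. *)
have [c cE] : exists c, forall j, j \in cinterval (tnth S l).1 (tnth S l).2 ->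
    (((tnth S l).1 <= j) + (j < i))%N = c.
  move: iout; rewrite /cspan in_setD1 -val_eqE /=; case: (tnth S l) => a b /=.
  rewrite /cinterval; case: ifP => leab; rewrite inE => iab.
    (* Without wrap-around, either [i <= a] and only the first sum counts [j], or [b < i] and both
       do. *)
    by exists (b < i).+1%N => j; rewrite inE; lia.
  (* With wrap-around, [b < i <= a]: the first sum counts the [j >= a], the second the [j <= b]. *)
  by exists 1%N => j; rewrite inE; lia.
have [_ _ zG] := spanS l; rewrite row_bcjr_mx 1?ltnW //.
rewrite !(big_mkcond (fun _ => (_ <= _)%N)) -big_split /=.
transitivity (row l (G *m H^T) *+ c); last by rewrite GH row0 mul0rn.
rewrite row_mul mulmx_sum_row -sumrMnl; apply: eq_bigr => j _.
rewrite !mxE -!mulrb -mulrnDr.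
case: (boolP (j \in cinterval (tnth S l).1 (tnth S l).2)) => [/cE -> // | /zG].
by rewrite mxE => ->; rewrite scale0r !mul0rn.
Qed.

(** [M_i] erases exactly the rows whose span misses [i], and those rows of [N_i] are already
    zero. *)
Lemma product_bcjr_mx (i : 'I_n) :
  product_mx F S i *m bcjr_mx G H S i = bcjr_mx G H S i.
Proof.
apply/row_matrixP => l; rewrite mul_diag_mx; apply/rowP => j; rewrite !mxE.
case: (boolP (i \in cspan (tnth S l))) => [_ | /row_bcjr_mx_out/rowP/(_ j)].
  by rewrite mul1r.
by rewrite !mxE mul0r => ->.
Qed.

Lemma bcjr_mx_ordS (i : 'I_n) :
  bcjr_mx G H S (ordS i) = bcjr_mx G H S i + col i G *m row i H^T.
Proof.
rewrite -bcjr_mxS -[nat_of_ord (ordS i)]/(i.+1 %% n)%N.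
(* Only [i.+1 = n] wraps around, and there [N_n = N_0]. *)
have := ltn_ord i; rewrite leq_eqVlt => /orP[/eqP -> | /modn_small -> //].
by rewrite modnn (bcjr_mx_n S GH).
Qed.

Lemma bcjr_edge_label_code (c : 'rV[F]_n) :
  edge_label_code (bcjr_trellis G H S) c -> c *m H^T = 0.
Proof.
case=> v vE; have step i : c 0 i *: row i H^T = val (v (ordS i)) - val (v i).
  have [u [-> -> ->]] := vE i; rewrite /= bcjr_mx_ordS mulmxDr addrC addKr.
  by rewrite mulmxA -mul_scalar_mx -mx11_scalar.
rewrite mulmx_sum_row (eq_bigr _ (fun i _ => step i)) sumrB.
(* [ordS] permutes the time axis, so the two sums coincide. *)
by rewrite [X in _ - X](reindex_inj (@ordS_inj n)) subrr.
Qed.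

End BCJR.

(** Using the same [u] at every time closes up to a cycle, whatever the matrices [X] are. *)
Lemma edge_label_code_matrix_trellis (F : fieldType) (k r n : nat)
    (G : 'M[F]_(k, n)) (X : 'I_n -> 'M[F]_(k, r)) (u : 'rV[F]_k) :
  edge_label_code (matrix_trellis G X) (u *m G).
Proof.
exists (fun i => mximv (X i) u) => i; exists u; split=> //.
by rewrite !mxE; apply: eq_bigr => j _; rewrite mxE.
Qed.

Lemma trellis_iso_edge_label_code (F : fieldType) (n : nat)
    (T T' : trellis F n) (c : 'rV[F]_n) :
  trellis_iso T T' -> edge_label_code T c <-> edge_label_code T' c.
Proof.
case=> phi [phi_bij phiE]; split=> [[v vE] | [w wE]].
  by exists (fun i => phi i (v i)) => i; apply/phiE.
(* Preimages exist at each time separately; finiteness of ['I_n] assembles them into one family. *)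
have /fin_all_exists[v vE] i : exists x, phi i x = w i.
  by have [psi _ phiK] := phi_bij i; exists (psi (w i)).
by exists v => i; apply/phiE; rewrite !vE.
Qed.

Theorem theorem4p14 (F : finFieldType) (n k : nat) (C : {vspace 'rV[F]_n})
    (G : 'M[F]_(k, n)) (H : 'M[F]_(n - k, n)) (S : k.-tuple ('I_n * 'I_n)) :
  \dim C = k ->
  full_support C ->
  C = mxim G ->
  C = mxker H^T ->
  is_span_list G S ->
  (forall i : 'I_n, exists W : {vspace 'rV[F]_k}, complement_at G H S i W) /\
  (forall W : 'I_n -> {vspace 'rV[F]_k},
     (forall i : 'I_n, complement_at G H S i (W i)) ->
     trellis_iso (quotient_trellis G S W) (bcjr_trellis G H S) /\
     (forall c : 'rV[F]_n,
        edge_label_code (quotient_trellis G S W) c <-> c \in C)).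
Proof.
move=> _ _ CG CH spanS.
have GH : G *m H^T = 0.
  apply/row_matrixP => l; rewrite row_mul row0 rowE; apply/eqP.
  by rewrite -mem_mxker -CH CG mem_mxim.
have MM := product_mx_idem F S.
have MN := product_bcjr_mx GH spanS.
split=> [i | W WP].
  exists (mxim (product_mx F S i) :&: mxker (bcjr_mx G H S i))%VS.
  have [direct sumE] := mxker_idem_complement (MM i) (MN i).
  by split=> //; apply: capvSl.
have capW i : (mxim (product_mx F S i) :&: mxker (bcjr_mx G H S i))%VS = W i.
  by have [sWM _ sumE] := WP i; exact (mxker_capv_im (MM i) sWM sumE).
have iso : trellis_iso (quotient_trellis G S W) (bcjr_trellis G H S).
  exists (fun i => quot_mulmx (capW i)); split=> [i | i v a w].
    exact: quot_mulmx_bij (MN i) (capW i).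
  (* The same [u] witnesses both edges; on the way back, injectivity identifies its classes with [v]
     and [w]. *)
  split=> -[u [vE aE wE]]; exists u; split=> //.
  - by rewrite vE quot_mulmxE.
  - by rewrite wE quot_mulmxE.
  - by apply: (quot_mulmx_inj (MN i)); rewrite vE quot_mulmxE.
  - by apply: (quot_mulmx_inj (MN (ordS i))); rewrite wE quot_mulmxE.
split=> // c; apply: (iff_trans (trellis_iso_edge_label_code c iso)).
split=> [/(bcjr_edge_label_code GH) cH | ].
  by rewrite CH mem_mxker cH.
by rewrite CG => /mximP[u ->]; apply: edge_label_code_matrix_trellis.
Qed.
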